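(* Let $\eta\in(1,\infty)$, let $G$ be a subgroup of $\mathbb{R}$ with $\mathbb{Z}\subseteq G$, and let $(K,v)$ be a complete valued field such that $G\subseteq v(K)$ and the residue field of $(K,v)$ is infinite. Put $R=\{0\}\cup\{\eta^{-g}\mid g\in G\}$ and equip $K$ with the ultrametric $d(x,y)=\eta^{-v(x-y)}$ (with $\eta^{-\infty}=0$). Then $(K,d)$ is $(R,\aleph_0)$-haloed. In particular, $(K,d)$ is universal for all separable $R$-valued ultrametric spaces, i.e., every separable $R$-valued ultrametric space embeds isometrically into $(K,d)$.
   Context: A valued field $(K,v)$ is a field with a map $v\colon K\to\mathbb{R}\sqcup\{\infty\}$ such that $v(x)=\infty$ iff $x=0$, $v(xy)=v(x)+v(y)$, and $v(x+y)\ge\min\{v(x),v(y)\}$. Its residue field is $\{x\mid v(x)\ge0\}/\{x\mid v(x)>0\}$. It is complete if it is complete with respect to the metric $\eta^{-v(x-y)}$. A metric space is $R$-valued if all its distances lie in $R$. An ultrametric space $(X,d)$ is $(R,\aleph_0)$-haloed if for every $a\in X$ and every $r\in R\setminus\{0\}$ there is a subset $A$ of the closed ball $\{x\in X\mid d(a,x)\le r\}$ such that $\aleph_0\le\operatorname{Card}(A)$ and $d(x,y)=r$ for all distinct $x,y\in A$. *)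

(* Defs.v *)
From HB Require Import structures.
From mathcomp Require Import all_boot all_order all_algebra.
From mathcomp Require Import ring_quotient.
From mathcomp Require Import all_classical all_reals all_analysis.

Set Implicit Arguments.
Unset Strict Implicit.
Unset Printing Implicit Defensive.

Import Order.TTheory GRing.Theory Num.Theory.

Local Open Scope classical_set_scope.
Local Open Scope ring_scope.

HB.mixin Record Metric_isUltrametric (R : realType) X & Metric R X := {
  ultrametric_triangle : forall x y z : X,
    mdist x z <= Num.max (mdist x y) (mdist y z) :> R
}.

#[short(type="ultrametricType")]
HB.structure Definition Ultrametric (R : realType) :=
  {X of Metric R X & Metric_isUltrametric R X}.

(* The values of a valuation lie in R together with +oo: the type \bar R also
   contains -oo, which [val_neqNy] excludes. *)
Record valuation (R : realType) (K : fieldType) := Valuation {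
  val_fun :> K -> \bar R;
  val_neqNy : forall x, val_fun x <> -oo%E;
  val_eqy : forall x, val_fun x = +oo%E <-> x = 0;
  valM : forall x y, val_fun (x * y) = (val_fun x + val_fun y)%E;
  valD : forall x y, (mine (val_fun x) (val_fun y) <= val_fun (x + y))%E
}.

Section ValuationTheory.
Context (R : realType) (K : fieldType) (v : valuation R K).

Lemma val0 : v 0 = +oo%E.
Proof. exact/val_eqy. Qed.

Lemma val_fin x : x != 0 -> v x \is a fin_num.
Proof.
move=> x0; rewrite fin_numE; apply/andP; split; apply/eqP.
  exact: val_neqNy.
by move/val_eqy => /eqP; rewrite (negbTE x0).
Qed.

Lemma val1 : v 1 = 0%E.
Proof.
have := valM v 1 1; rewrite mulr1.
have := val_fin (oner_neq0 K); case: (v 1) => // r _ [] /eqP.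
by rewrite -subr_eq0 opprD addrA subrr add0r oppr_eq0 => /eqP ->.
Qed.

Lemma valN1 : v (-1) = 0%E.
Proof.
have := valM v (-1) (-1); rewrite mulrNN mulr1 val1.
have : v (-1) \is a fin_num by rewrite val_fin// oppr_eq0 oner_neq0.
case: (v (-1)) => // r _ [] /esym/eqP.
by rewrite -mulr2n mulrn_eq0/= => /eqP ->.
Qed.

Lemma valN x : v (- x) = v x.
Proof. by rewrite -mulN1r valM valN1 add0e. Qed.

Lemma valV x : x != 0 -> v x^-1 = (- v x)%E.
Proof.
move=> x0; have := valM v x x^-1; rewrite mulfV// val1.
have xV0 : x^-1 != 0 by rewrite invr_eq0.
have := val_fin x0; have := val_fin xV0.
case: (v x^-1) => // s _; case: (v x) => // r _ [] /esym/eqP.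
by rewrite addrC addr_eq0 => /eqP ->.
Qed.

End ValuationTheory.

Section ResidueField.
Context (R : realType) (K : fieldType) (v : valuation R K).

Definition valring_pred : {pred K} := [pred x | (0 <= v x)%E].

Lemma valring_pred_subring : subring_closed valring_pred.
Proof.
split=> [|x y|x y]; rewrite !inE ?val1//= => x0 y0.
  by rewrite (le_trans _ (valD v _ _))// le_min x0 valN.
by rewrite valM adde_ge0.
Qed.

HB.instance Definition _ :=
  GRing.isSubringClosed.Build K valring_pred valring_pred_subring.

Record valring := ValRing {
  valring_val :> K;
  _ : valring_val \in valring_pred
}.

HB.instance Definition _ := [isSub for valring_val].
HB.instance Definition _ := [Choice of valring by <:].
HB.instance Definition _ := [SubChoice_isSubComNzRing of valring by <:].

Definition valmax : {pred valring} := [pred x : valring | (0 < v (val x))%E].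

Lemma valmax_ideal : idealr_closed valmax.
Proof.
split=> [||a x y]; rewrite !inE/= ?val0 ?val1 ?ltxx// => x0 y0.
rewrite (lt_le_trans _ (valD v _ _))// lt_min y0 andbT valM.
by rewrite (lt_le_trans x0)// -[leLHS]add0e leeD2r//; case: a.
Qed.

HB.instance Definition _ := isIdealr.Build valring valmax valmax_ideal.

Definition residue_field := {ideal_quot valmax}.

HB.instance Definition _ := GRing.ComNzRing.on residue_field.

End ResidueField.

Arguments valring_pred {R K} v : rename.
Arguments valmax {R K} v : rename.

Section ResidueFieldTheory.
Context (R : realType) (K : fieldType) (v : valuation R K).
Local Open Scope quotient_scope.

Lemma residue_mulVf (a : residue_field v) :
  exists b : residue_field v, a != 0 -> b * a = 1.
Proof.
rewrite -[a]reprK; set x := repr a.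
have pi0 : \pi_(residue_field v) 0 = 0 by rewrite piE.
have pi1 : \pi_(residue_field v) 1 = 1 by rewrite piE.
have [xm|xm] := boolP (x \in valmax v).
  by exists 0; rewrite -pi0 -Quotient.idealrBE subr0 xm.
have vx0 : v (val x) = 0%E.
  apply/eqP; rewrite eq_le leNgt; apply/andP; split; first exact: xm.
  by case: x {xm}.
have x0 : val x != 0 by apply/eqP => /(val_eqy v); rewrite vx0.
have xV : (val x)^-1 \in valring_pred v.
  by rewrite inE/= valV// vx0 oppe0.
exists (\pi_(residue_field v) (ValRing xV)) => _.
have <- : \pi_(residue_field v) (ValRing xV * x) =
    \pi_(residue_field v) (ValRing xV) * \pi_(residue_field v) x.
  exact: Quotient.pi_mul.
rewrite -pi1; congr (\pi _); apply: val_inj => /=.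
by rewrite mulVf.
Qed.

Let inv (a : residue_field v) : residue_field v :=
  if a == 0 then 0 else xget 0 [set b | b * a = 1].

Let inv_mulVf (a : residue_field v) : a != 0 -> inv a * a = 1.
Proof.
move=> a0; rewrite /inv (negbTE a0); case: xgetP => [b _ //|] nb.
by have [b /(_ a0) /nb] := residue_mulVf a.
Qed.

Let inv0 : inv 0 = 0. Proof. by rewrite /inv eqxx. Qed.

HB.instance Definition _ :=
  GRing.ComNzRing_isField.Build (residue_field v) inv_mulVf inv0.

End ResidueFieldTheory.

(* The carrier of K, equipped with the distance eta^(- v (x - y)). *)
Definition valued_space (R : realType) (K : fieldType) (v : valuation R K)
  (eta : R) (eta1 : 1 < eta) : Type := K.

Section ValuedSpace.
Context (R : realType) (K : fieldType) (v : valuation R K).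
Context (eta : R) (eta1 : 1 < eta).
Local Notation X := (valued_space v eta1).

HB.instance Definition _ := GRing.Field.on X.
HB.instance Definition _ := isPointed.Build X 0.

Definition vabs (x : K) : R := if v x is r%:E then eta `^ (- r) else 0.

Definition vdist (x y : X) : R := vabs (x - y).

Lemma vabs_ge0 x : 0 <= vabs x.
Proof. by rewrite /vabs; case: (v x) => // r; exact: powR_ge0. Qed.

Lemma vabs_eq0 x : vabs x = 0 -> x = 0.
Proof.
move=> vx; apply/eqP/negP => /negP /(val_fin v) x0; move: vx x0; rewrite /vabs.
case: (v x) => // r /eqP; rewrite powR_eq0 => /andP[/eqP eta0].
by have := lt_trans ltr01 eta1; rewrite eta0 ltxx.
Qed.

Lemma vabs_le x y : (v y <= v x)%E -> vabs x <= vabs y.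
Proof.
rewrite /vabs; have := @val_neqNy _ _ v y.
case: (v y) => [s _|_|//].
  case: (v x) => [r|_|]; last by [].
    by rewrite lee_fin => sr; rewrite ler_powR ?(ltW eta1)// lerN2.
  exact: powR_ge0.
by rewrite leye_eq => /eqP ->.
Qed.

Lemma vdist_ultra (x y z : X) :
  vdist x z <= Num.max (vdist x y) (vdist y z).
Proof.
rewrite /vdist -[x - z](subrKA y) le_max.
have := valD v (x - y) (y - z); rewrite ge_min.
by case/orP => /vabs_le ->; rewrite ?orbT.
Qed.

Let vdistxx x : vdist x x = 0.
Proof. by rewrite /vdist subrr /vabs val0. Qed.

Let vdist_eq0 x y : vdist x y = 0 -> x = y.
Proof. by move/vabs_eq0/eqP; rewrite subr_eq0 => /eqP. Qed.

Let vdistC x y : vdist x y = vdist y x.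
Proof. by rewrite /vdist /vabs -opprB valN. Qed.

Let vdist_triangle y x z : vdist x z <= vdist x y + vdist y z.
Proof.
rewrite (le_trans (vdist_ultra x y z))// ge_max.
by rewrite lerDl lerDr !vabs_ge0.
Qed.

HB.instance Definition _ :=
  isMetric.Build R X vdistxx vdist_eq0 vdistC vdist_triangle.

HB.instance Definition _ := Metric_isUltrametric.Build R X vdist_ultra.

End ValuedSpace.

Definition complete_uniform (T : puniformType) :=
  forall F : set_system T, ProperFilter F -> cauchy F -> cvg F.

Definition separable (T : topologicalType) :=
  exists2 D : set T, countable D & dense D.

Definition valued_in (R : realType) (X : metricType R) (S : set R) :=
  forall x y : X, S (mdist x y).

(* The cardinal kappa of the usual definition is represented by a set C of
   that cardinality. *)
Definition haloed (R : realType) (X : ultrametricType R) (S : set R)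
    (I : Type) (C : set I) :=
  forall (a : X) (r : R), S r -> r != 0 ->
  exists A : set X,
    [/\ A `<=` [set x | mdist a x <= r],
        (C #<= A)%card
      & forall x y, A x -> A y -> x <> y -> mdist x y = r].

Definition isometric_embedding (R : realType) (X Y : metricType R)
    (f : X -> Y) :=
  forall x y, mdist (f x) (f y) = mdist x y.

Definition universal_separable (R : realType) (Y : metricType R) (S : set R) :=
  forall X : ultrametricType R, separable X -> valued_in X S ->
  exists f : X -> Y, isometric_embedding f.

(* Main.v *)
(**
A valued field with infinite residue field and enough values is haloed: if
[v x = g], the points [a + x c], with [c] running over representatives of the
residue classes, are at mutual distance [eta^(-g)]. Infinite halos let any
isometry defined on finitely many points be extended to one more point [a]: if
the nearest point [x] of [a] is at distance [r > 0], each ball of radius [r]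
around one of the finitely many image points meets the halo of the image of [x]
in at most one point, so some point of the halo is at distance at least [r] from
all of them, and the ultrametric inequality forces all its distances. Iterating
along a dense sequence and completing gives the embedding.
*)
Require Import Defs.
From mathcomp Require Import all_boot all_order all_algebra.
From mathcomp Require Import all_classical all_reals all_analysis.

Set Implicit Arguments.
Unset Strict Implicit.
Unset Printing Implicit Defensive.

Import Order.TTheory GRing.Theory Num.Theory.

Local Open Scope classical_set_scope.
Local Open Scope ring_scope.

Lemma infinite_image_inj (T U : Type) (f : T -> U) (A : set T) :
  {in A &, injective f} -> infinite_set A -> infinite_set (f @` A).
Proof. by move=> /inj_card_eq/eq_finite_set ->. Qed.

(** Used below to replace a point by a nearby one without changing its distance to a third, so that
    no limit of distances is ever taken. *)
Lemma isosceles (R : realType) (X : ultrametricType R) (a b c : X) :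
  mdist a b < mdist a c -> mdist b c = mdist a c.
Proof.
move=> abc; apply/le_anti/andP; split.
  have := ultrametric_triangle b a c.
  by rewrite (metric_sym b a) (max_idPr (ltW abc)).
have := ultrametric_triangle a b c; rewrite le_max => /orP[|//].
by rewrite leNgt abc.
Qed.

(** Pigeonhole: if every point of [A] were closer than [r] to some [y i], two distinct points would
    share an index and so be closer than [r] to each other. *)
Lemma exists_far_point (R : realType) (Y : ultrametricType R) (A : set Y)
    (r : R) (I : finType) (y : I -> Y) :
  infinite_set A ->
  (forall a b, A a -> A b -> a <> b -> mdist a b = r) ->
  exists2 b, A b & forall i, r <= mdist b (y i).
Proof.
move=> Ainf Ar; apply: contrapT => nofar.
have near_y b : exists i, A b -> mdist b (y i) < r.
  have [Ab|nAb] := pselect (A b); last first.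
    (* Off [A] any index serves. One exists, since for empty [I] a point of [A] would be far
       vacuously. *)
    have [a Aa] := infinite_setN0 Ainf.
    have [[i _]|noi] := pselect (exists i : I, True); first by exists i.
    by case: nofar; exists a => // i; case: noi; exists i.
  apply: contrapT => far; case: nofar; exists b => // i.
  by rewrite leNgt; apply/negP => lt_r; apply: far; exists i.
have [g gP] := choice near_y.
suff /infinite_image_inj : {in A &, injective g} by move=> /(_ Ainf); apply.
move=> a b; rewrite !inE => Aa Ab gab; apply: contrapT => /(Ar _ _ Aa Ab) abr.
have := ultrametric_triangle a (y (g a)) b.
by rewrite abr leNgt gt_max gP// gab metric_sym gP.
Qed.

Section Embedding.
Context (R : realType) (S : set R) (X Y : ultrametricType R).
Hypothesis XS : valued_in X S.
Hypothesis Yhaloed : haloed Y S [set: nat].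

Lemma one_point_extension (y0 : Y) (I : finType) (x : I -> X) (y : I -> Y)
    (a : X) :
  (forall i j, mdist (y i) (y j) = mdist (x i) (x j)) ->
  exists b, forall i, mdist b (y i) = mdist a (x i).
Proof.
move=> yx; have [[j _]|noi] := pselect (exists i : I, True); last first.
  by exists y0 => i; case: noi; exists i.
pose i0 := [arg min_(i < j) mdist a (x i)]%O.
have i0min i : mdist a (x i0) <= mdist a (x i).
  by rewrite /i0; case: arg_minP => // k _; apply.
have [/mdist_positivity a_i0|r0] := eqVneq (mdist a (x i0)) 0.
  by exists (y i0) => i; rewrite yx -a_i0.
have [A [Aball /infiniteP Ainf Ar]] := Yhaloed (y i0) (XS a (x i0)) r0.
have [b Ab bfar] := exists_far_point y Ainf Ar.
(* If [x i] is farther from [a] than [x i0], two isosceles triangles with apex at [a] and at [y i0]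
   settle the distance. *)
exists b => i; have [lt_i|le_i] := ltP (mdist a (x i0)) (mdist a (x i)).
  have xi := isosceles lt_i.
  rewrite -xi -yx; apply: isosceles.
  by rewrite (le_lt_trans (Aball _ Ab))// yx xi.
(* At a tie with [i0], the choice of [b] gives the lower bound and the triangle through [y i0] the
   upper one. *)
have ai : mdist a (x i) = mdist a (x i0).
  by apply/le_anti; rewrite le_i i0min.
apply/le_anti/andP; split; last by rewrite ai bfar.
rewrite (le_trans (ultrametric_triangle _ (y i0) _))// ge_max.
rewrite metric_sym ai Aball//= yx.
by rewrite (le_trans (ultrametric_triangle _ a _))// ai metric_sym maxxx.
Qed.

Lemma isometric_sequence (y0 : Y) (x : nat -> X) :
  exists y : nat -> Y, forall i j, mdist (y i) (y j) = mdist (x i) (x j).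
Proof.
pose next (s : seq Y) := xget y0
  [set b | forall i : 'I_(size s),
           mdist b (nth y0 s i) = mdist (x (size s)) (x i)].
pose prefix n := iter n (fun s => rcons s (next s)) [::].
pose y n := next (prefix n).
have size_prefix n : size (prefix n) = n.
  by elim: n => //= n IHn; rewrite size_rcons IHn.
have nth_prefix n i : (i < n)%N -> nth y0 (prefix n) i = y i.
  elim: n => //= n IHn; rewrite ltnS leq_eqVlt nth_rcons size_prefix.
  by case/predU1P => [->|lt_in]; [rewrite ltnn eqxx | rewrite lt_in IHn].
have yn n i : (i < n)%N -> mdist (y n) (y i) = mdist (x n) (x i).
  elim/ltn_ind: n i => n IHn i lt_in.
  have yx_ltn (j k : 'I_n) : mdist (y j) (y k) = mdist (x j) (x k).
    have [lt_jk|lt_kj|->] := ltngtP j k.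
    - by rewrite metric_sym (metric_sym (x j)) IHn.
    - exact: IHn.
    - by rewrite !mdistxx.
  have [b bP] := one_point_extension y0 (x n) yx_ltn.
  rewrite {1}/y /next -(nth_prefix _ _ lt_in); case: xgetP => [c _ /=|/(_ b)].
    by rewrite size_prefix => /(_ (Ordinal lt_in)).
  by case=> /=; rewrite size_prefix => k; rewrite nth_prefix.
exists y => i j; have [lt_ij|lt_ji|->] := ltngtP i j.
- by rewrite metric_sym (metric_sym (x i)) yn.
- exact: yn.
- by rewrite !mdistxx.
Qed.

Hypothesis Ycomplete :
  forall F : set_system Y, ProperFilter F -> cauchy F -> exists y : Y, F --> y.

Lemma isometric_extension (x : nat -> X) (y : nat -> Y) :
  (forall i j, mdist (y i) (y j) = mdist (x i) (x j)) ->
  (forall (a : X) (e : R), 0 < e -> exists i, mdist a (x i) < e) ->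
  exists f : X -> Y, isometric_embedding f.
Proof.
move=> yx xdense.
have lim_y a : exists b, forall e : R, 0 < e ->
    exists i, mdist a (x i) < e /\ mdist b (y i) < e.
  (* Images of the [x i] near [a] generate a Cauchy filter because [y] preserves distances; its
     limit is the candidate for [f a]. *)
  pose F : set_system Y :=
    filter_from [set e : R | 0 < e] (fun e => y @` [set i | mdist a (x i) < e]).
  have FF : ProperFilter F.
    apply: filter_from_proper => [|e /= e0]; last first.
      by have [i ai] := xdense a e e0; exists (y i), i.
    apply: filter_from_filter; first by exists 1 => /=.
    move=> d e /= d0 e0; exists (Num.min d e); first by rewrite /= lt_min d0.
    by move=> _ [i /= + <-]; rewrite lt_min => /andP[? ?]; split; exists i.
  have [|b /fcvg_ballP bF] := Ycomplete FF.
    apply/cauchyP => e e0; have [i ai] := xdense a e e0.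
    exists (y i), e => //= _ [j /= aj <-]; rewrite ballEmdist /= yx.
    rewrite (le_lt_trans (ultrametric_triangle _ a _))// gt_max aj.
    by rewrite metric_sym ai.
  exists b => e e0; have [d /= d0 dF] := bF e e0.
  have [|i] := xdense a (Num.min d e); first by rewrite lt_min d0.
  rewrite lt_min => /andP[aid aie]; exists i; split => //.
  by have := dF (y i); rewrite ballEmdist; apply; exists i.
have [f fP] := choice lim_y; exists f => a b.
have [->|/eqP ab] := pselect (a = b); first by rewrite !mdistxx.
rewrite -mdist_gt0 in ab.
(* Precision [mdist a b] is enough: four isosceles triangles replace [a], [b] by [x i], [x j], then
   [y i], [y j] by [f a], [f b]. *)
have [i [ai fai]] := fP a _ ab; have [j [bj fbj]] := fP b _ ab.
have xib : mdist b (x i) = mdist a b by rewrite metric_sym; apply: isosceles.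
have xji : mdist (x j) (x i) = mdist a b.
  by rewrite -xib; apply: isosceles; rewrite xib.
have yja : mdist (y j) (f a) = mdist a b.
  have yij : mdist (y i) (y j) = mdist a b by rewrite yx metric_sym.
  by rewrite metric_sym -yij; apply: isosceles; rewrite metric_sym yij.
by rewrite metric_sym -yja; apply: isosceles; rewrite metric_sym yja.
Qed.

Lemma separable_embedding (y0 : Y) :
  separable X -> exists f : X -> Y, isometric_embedding f.
Proof.
case=> D Dcount Ddense.
have Dnear (a : X) (e : R) : 0 < e -> exists2 d, D d & mdist a d < e.
  move=> e0; have := Ddense (interior (ball a e)).
  case=> [||d [/interior_subset + Dd]].
  - by exists a; exact: nbhsx_ballx.
  - exact: open_interior.
  - by rewrite ballEmdist; exists d.
(* If [D] is empty then so is [X] by density, and a constant map works; otherwise a sequence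
   enumerates [D]. *)
have [D0|/surjfunPex[x Dx]] := pfcard_geP Dcount.
  exists (fun=> y0) => a; have [d] := Dnear a 1 ltr01.
  by rewrite D0.
have [y yx] := isometric_sequence y0 x.
apply: isometric_extension yx _ => a e /(Dnear a)[d Dd ad].
by move: Dd; rewrite Dx => -[i _ id]; exists i; rewrite id.
Qed.

End Embedding.

(** The difference of representatives lies in the valuation ring, but outside its maximal ideal
    since the classes differ. *)
Lemma val_repr_sub (R : realType) (K : fieldType) (v : valuation R K)
    (c d : residue_field v) :
  c != d -> v (val (repr c) - val (repr d)) = 0%E.
Proof.
move=> cd; have ncd : repr c - repr d \notin valmax v.
  by rewrite Quotient.idealrBE !reprK.
apply/le_anti; rewrite leNgt; apply/andP; split; first exact: ncd.
exact: (valP (repr c - repr d)).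
Qed.

Lemma haloed_valued_space (R : realType) (K : fieldType) (v : valuation R K)
    (eta : R) (eta1 : 1 < eta) (G : set R) :
  (forall g, G g -> exists x : K, v x = g%:E) ->
  infinite_set [set: residue_field v] ->
  haloed (valued_space v eta1) ([set 0] `|` [set eta `^ (- g) | g in G])
    [set: nat].
Proof.
move=> Gv resinf a r [->/eqP//|[g Gg <-] r0].
have [x vx] := Gv g Gg.
pose point (c : residue_field v) : valued_space v eta1 := a + x * val (repr c).
have dist_point c d : c != d -> mdist (point c) (point d) = eta `^ (- g).
  move=> /val_repr_sub cd; rewrite /mdist/= /vdist /vabs /point.
  by rewrite opprD addrACA subrr add0r -mulrBr Defs.valM vx cd adde0.
exists (range point); split.
- move=> _ [c _ <-] /=; rewrite /mdist/= /vdist /point opprD addrA subrr add0r.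
  have -> : eta `^ (- g) = vabs v eta x by rewrite /vabs vx.
  apply: vabs_le => //; rewrite valN Defs.valM leeDl//.
  exact: (valP (repr c)).
(* Distinct classes give distinct points, their distance [r] being nonzero. *)
- apply/infiniteP; apply: infinite_image_inj resinf => c d _ _ cd.
  apply/eqP; apply: contraTT isT => /dist_point.
  by rewrite cd mdistxx => /esym/eqP; rewrite (negbTE r0).
- move=> _ _ [c _ <-] [d _ <-] cd; apply: dist_point.
  by apply: contra_notN cd => /eqP ->.
Qed.

Theorem theorem4p2 (R : realType) (eta : R) (eta1 : 1 < eta)
    (G : {pred R}) (Gsubgroup : zmod_closed G)
    (ZG : forall n : int, n%:~R \in G)
    (K : fieldType) (v : valuation R K)
    (Kcomplete : complete_uniform (valued_space v eta1))
    (Gv : forall g : R, g \in G -> exists x : K, v x = g%:E)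
    (residue_infinite : infinite_set [set: residue_field v]) :
  let S : set R := [set 0] `|` [set eta `^ (- g) | g in [set` G]] in
  haloed (valued_space v eta1) S [set: nat] /\
  universal_separable (valued_space v eta1) S.
Proof.
move=> S.
have Khaloed : haloed (valued_space v eta1) S [set: nat].
  exact: haloed_valued_space.
split=> // X Xsep XS; apply: (separable_embedding XS Khaloed _ 0 Xsep).
by move=> F FF /(Kcomplete F FF); exists (lim F).
Qed.
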